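(* A compact Hausdorff flow $(X,T)$ has the property that every point of $X$ is almost automorphic if and only if $(X,T)$ is distal and the restriction of the action to every minimal subset of $X$ is equicontinuous.
   Context: $X$ compact Hausdorff, $T$ a topological group acting continuously on $X$. A point $x$ is almost automorphic if for every net $\{t_i\}\subset T$ with $t_ix\to y$ it holds that $t_i^{-1}y\to x$. The flow is distal if for any two distinct points $x\ne y$ there are no net $\{t_i\}\subset T$ and $z\in X$ with $t_ix\to z$ and $t_iy\to z$. A minimal set is a nonempty closed $T$-invariant subset $M$ in which every orbit is dense; $(M,T)$ is equicontinuous if for every entourage $\alpha$ of $M$ there is an entourage $\beta$ with $(x,y)\in\beta\Rightarrow(tx,ty)\in\alpha$ for all $t\in T$. *)

(* Defs.v *)
From Stdlib Require Import List.

Set Implicit Arguments.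
Unset Strict Implicit.

Record topology (X : Type) := Topology {
  is_open : (X -> Prop) -> Prop;
  open_full : is_open (fun _ => True);
  open_inter : forall U V, is_open U -> is_open V -> is_open (fun x => U x /\ V x);
  open_union : forall (I : Type) (F : I -> X -> Prop),
      (forall i, is_open (F i)) -> is_open (fun x => exists i, F i x)
}.

Definition is_closed {X} (tX : topology X) (A : X -> Prop) : Prop :=
  is_open tX (fun x => ~ A x).

Definition prod_open {X Y} (tX : topology X) (tY : topology Y)
    (W : X * Y -> Prop) : Prop :=
  forall p, W p -> exists U V, is_open tX U /\ is_open tY V /\ U (fst p) /\ V (snd p) /\
    forall a b, U a -> V b -> W (a, b).

Definition continuous {X Y} (tX : topology X) (tY : topology Y) (f : X -> Y) : Prop :=
  forall V, is_open tY V -> is_open tX (fun x => V (f x)).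

Definition continuous2 {X Y Z} (tX : topology X) (tY : topology Y) (tZ : topology Z)
    (f : X -> Y -> Z) : Prop :=
  forall W, is_open tZ W -> prod_open tX tY (fun p => W (f (fst p) (snd p))).

Definition compact {X} (tX : topology X) : Prop :=
  forall (I : Type) (F : I -> X -> Prop),
    (forall i, is_open tX (F i)) -> (forall x, exists i, F i x) ->
    exists l : list I, forall x, exists i, In i l /\ F i x.

Definition hausdorff {X} (tX : topology X) : Prop :=
  forall x y : X, x <> y -> exists U V, is_open tX U /\ is_open tX V /\ U x /\ V y /\
    forall z, U z -> V z -> False.

Record directed := Directed {
  dom :> Type;
  dle : dom -> dom -> Prop;
  dle_refl : forall a, dle a a;
  dle_trans : forall a b c, dle a b -> dle b c -> dle a c;
  dle_dir : forall a b, exists c, dle a c /\ dle b c;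
  dom_inhabited : inhabited dom
}.

Definition converges {X} (tX : topology X) (D : directed) (f : D -> X) (x : X) : Prop :=
  forall U, is_open tX U -> U x -> exists i0 : D, forall i, dle i0 i -> U (f i).

Definition topological_group {G} (tG : topology G)
    (mul : G -> G -> G) (inv : G -> G) (e : G) : Prop :=
  (forall a b c, mul a (mul b c) = mul (mul a b) c) /\
  (forall a, mul e a = a) /\ (forall a, mul a e = a) /\
  (forall a, mul (inv a) a = e) /\ (forall a, mul a (inv a) = e) /\
  continuous2 tG tG tG mul /\ continuous tG tG inv.

Definition continuous_action {G X} (tG : topology G) (tX : topology X)
    (mul : G -> G -> G) (e : G) (act : G -> X -> X) : Prop :=
  (forall x, act e x = x) /\
  (forall s t x, act (mul s t) x = act s (act t x)) /\
  continuous2 tG tX tX act.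

Section Flow.
Context {G X : Type} (tX : topology X) (inv : G -> G) (act : G -> X -> X).

Definition almost_automorphic (x : X) : Prop :=
  forall (D : directed) (t : D -> G) (y : X),
    converges tX (fun i => act (t i) x) y ->
    converges tX (fun i => act (inv (t i)) y) x.

Definition distal : Prop :=
  forall x y : X, x <> y ->
    ~ (exists (D : directed) (t : D -> G) (z : X),
         converges tX (fun i => act (t i) x) z /\ converges tX (fun i => act (t i) y) z).

Definition minimal_set (M : X -> Prop) : Prop :=
  (exists x, M x) /\ is_closed tX M /\
  (forall t x, M x -> M (act t x)) /\
  (forall x y, M x -> M y -> forall U, is_open tX U -> U y -> exists t, U (act t x)).

(** Entourages of M (with the subspace topology of X): relations containing
    the trace on M x M of a neighbourhood of the diagonal of M in X x X.
    For compact Hausdorff M these form its unique compatible uniformity. *)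
Definition entourage_of (M : X -> Prop) (alpha : X -> X -> Prop) : Prop :=
  exists W : X * X -> Prop, prod_open tX tX W /\
    (forall x, M x -> W (x, x)) /\
    (forall x y, M x -> M y -> W (x, y) -> alpha x y).

Definition equicontinuous_on (M : X -> Prop) : Prop :=
  forall alpha, entourage_of M alpha ->
    exists beta, entourage_of M beta /\
      forall x y, M x -> M y -> beta x y -> forall t : G, alpha (act t x) (act t y).

End Flow.

(* Main.v *)
(** If [t_i x] and [t_i y] both tend to [z], almost automorphy makes [t_i^-1 z] tend to
    both [x] and [y], so the flow is distal.

    For equicontinuity, almost automorphy at three points gives an iterated-limit
    principle: if [s_j x0] clusters at [x] and [(k_m x, k'_m x)] clusters at [(y, y')],
    then [(k_m s_j x0, k'_m s_j x0)] is close to [(y, y')] for suitable [j < m]. If no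
    open set met a minimal set in a set that the group keeps uniformly small, total
    boundedness would yield decreasing open sets [U_m], points [s_m x0] of
    [U_(m+1)], and group elements [k_m, k'_m] that are close on [s_j x0] for [j < m] but
    far apart on all of [U_(m+1)]; at cluster points this contradicts the principle.
    Minimality spreads the one uniformly small open set over the whole minimal set.

    Conversely, an orbit closure contains a minimal set [M], on which the action is
    equicontinuous; this yields a point of [M] proximal to [x], so distality puts [x]
    in [M], where equicontinuity gives almost automorphy. *)
Require Import Defs.
From Stdlib Require Import List.
From Stdlib Require Import Lia Classical FunctionalExtensionality
  PropExtensionality IndefiniteDescription.
From mathcomp Require classical_sets.

Set Bullet Behavior "Strict Subproofs".

(** * Open sets and cluster points *)

Section Topology.

Context {X : Type} (tX : topology X).

Lemma open_ext (U V : X -> Prop) :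
  (forall x, U x <-> V x) -> is_open tX U -> is_open tX V.
Proof.
  intros H HU. replace V with U; [exact HU|].
  apply functional_extensionality; intro x; apply propositional_extensionality, H.
Qed.

Lemma open_local (P : X -> Prop) :
  (forall x, P x -> exists U, is_open tX U /\ U x /\ forall y, U y -> P y) ->
  is_open tX P.
Proof.
  intro H.
  apply open_ext with
    (fun x => exists i : {U | is_open tX U /\ forall y, U y -> P y}, proj1_sig i x).
  - intro x; split.
    + intros [[U [oU UP]] Ux]; exact (UP x Ux).
    + intro Px. destruct (H x Px) as (U & oU & Ux & UP).
      now exists (exist _ U (conj oU UP)).
  - apply open_union; intros [U [oU UP]]; exact oU.
Qed.

Lemma open_or (U V : X -> Prop) :
  is_open tX U -> is_open tX V -> is_open tX (fun x => U x \/ V x).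
Proof.
  intros oU oV; apply open_local; intros x [Ux | Vx]; [exists U | exists V]; tauto.
Qed.

Lemma open_ex {I : Type} (F : I -> X -> Prop) (P : I -> Prop) :
  (forall i, P i -> is_open tX (F i)) -> is_open tX (fun x => exists i, P i /\ F i x).
Proof.
  intro oF; apply open_local; intros x (i & Pi & Fx).
  exists (F i); split; [auto | split; [exact Fx | eauto]].
Qed.

Lemma open_forall_list {I : Type} (F : I -> X -> Prop) (l : list I) :
  (forall i, In i l -> is_open tX (F i)) ->
  is_open tX (fun x => forall i, In i l -> F i x).
Proof.
  induction l as [|i l IH]; intro oF.
  - apply open_ext with (fun _ => True); [simpl; tauto | apply open_full].
  - apply open_ext with (fun x => F i x /\ forall j, In j l -> F j x).
    + intro x; split.
      * intros [Fi Fl] j [<- | Hj]; auto.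
      * intro H; split; [apply H; now left | intros j Hj; apply H; now right].
    + apply open_inter; [apply oF; now left | apply IH; intros; apply oF; now right].
Qed.

Lemma open_comp_pair (W : X * X -> Prop) (f g : X -> X) :
  prod_open tX tX W -> continuous tX tX f -> continuous tX tX g ->
  is_open tX (fun x => W (f x, g x)).
Proof.
  intros oW cf cg; apply open_local; intros x Wx.
  destruct (oW _ Wx) as (U & V & oU & oV & Ux & Vx & UV); simpl in *.
  exists (fun z => U (f z) /\ V (g z)); split; [|split].
  - apply open_inter; [now apply cf | now apply cg].
  - tauto.
  - intros z [Uz Vz]; auto.
Qed.

Lemma open_slice (W : X * X -> Prop) (a : X) :
  prod_open tX tX W -> is_open tX (fun b => W (a, b)).
Proof.
  intro oW; apply open_local; intros b Wb.
  destruct (oW _ Wb) as (U & V & oU & oV & Ua & Vb & UV); exists V; simpl in *; auto.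
Qed.

Lemma open_neq (Hhaus : hausdorff tX) (a : X) : is_open tX (fun x => x <> a).
Proof.
  apply open_local; intros x xa.
  destruct (Hhaus _ _ xa) as (U & V & oU & oV & Ux & Va & UV).
  exists U; split; [exact oU | split; [exact Ux | intros y Uy ->; eauto]].
Qed.

(* [B] is a filter base on [I]; the point found is a cluster point of [f] along it. *)
Lemma cluster_point (Hcomp : compact tX) {I : Type} (B : (I -> Prop) -> Prop) (f : I -> X) :
  (exists b, B b) ->
  (forall b, B b -> exists i, b i) ->
  (forall b c, B b -> B c -> exists d, B d /\ forall i, d i -> b i /\ c i) ->
  exists y, forall N, is_open tX N -> N y -> forall b, B b -> exists i, b i /\ N (f i).
Proof.
  intros [b0 Bb0] Bne Bdir. apply NNPP; intro H.
  (* Without a cluster point, the open sets that [f] avoids on some member of [B] cover [X]. A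
     member of [B] below those attached to a finite subcover contains an index whose value lies in
     none of them. *)
  destruct (Hcomp {N | is_open tX N /\ exists b, B b /\ forall i, b i -> ~ N (f i)}
              (fun N => proj1_sig N)) as [l Hl].
  - intros [N [oN ?]]; exact oN.
  - intro y. apply NNPP; intro Hy; apply H; exists y; intros N oN Ny b Bb.
    apply NNPP; intro Hi. apply Hy.
    unshelve eexists (exist _ N _); [|exact Ny].
    split; [exact oN|]. exists b; split; [exact Bb|].
    intros i bi Ni; apply Hi; eauto.
  - assert (Hb : exists b, B b /\ forall N, In N l -> forall i, b i -> ~ proj1_sig N (f i)).
    { clear Hl. induction l as [|N l (b & Bb & IH)].
      - exists b0; simpl; tauto.
      - destruct N as [N (oN & c & Bc & Hc)].
        destruct (Bdir b c Bb Bc) as (d & Bd & Hd). exists d; split; [exact Bd|].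
        intros N' [<- | HN] i di; destruct (Hd i di); simpl; eauto. }
    destruct Hb as (b & Bb & Hb). destruct (Bne b Bb) as [i bi].
    destruct (Hl (f i)) as (N & HN & Nf). exact (Hb N HN i bi Nf).
Qed.

Lemma sequence_cluster_point (Hcomp : compact tX) (f : nat -> X) :
  exists y, forall N, is_open tX N -> N y -> forall n0, exists n, n0 <= n /\ N (f n).
Proof.
  destruct (cluster_point Hcomp (fun b => exists n0, forall n, b n <-> n0 <= n) f)
    as [y Hy].
  { exists (fun n => 0 <= n), 0; tauto. }
  { intros b [n0 Hb]; exists n0; now apply Hb. }
  { intros b c [n Hb] [m Hc]. exists (fun i => n + m <= i); split.
    - exists (n + m); tauto.
    - intros i Hi; rewrite Hb, Hc; lia. }
  exists y; intros N oN Ny n0. apply (Hy N oN Ny (fun n => n0 <= n)). exists n0; tauto.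
Qed.

(** Clustering is made joint by choosing [y] first and then clustering [g] only along the late
    indices at which [f] is near [y]. *)
Lemma pair_sequence_cluster_point (Hcomp : compact tX) (f g : nat -> X) :
  exists y z, forall U V n0, is_open tX U -> is_open tX V -> U y -> V z ->
    exists n, n0 <= n /\ U (f n) /\ V (g n).
Proof.
  destruct (sequence_cluster_point Hcomp f) as [y Hy].
  destruct (cluster_point Hcomp (fun b => exists n0 N, is_open tX N /\ N y /\
      forall n, b n <-> n0 <= n /\ N (f n)) g) as [z Hz].
  { exists (fun n => 0 <= n /\ True), 0, (fun _ => True).
    repeat split; auto using open_full; tauto. }
  { intros b (n0 & N & oN & Ny & Hb).
    destruct (Hy N oN Ny n0) as (i & Hi & Ni). exists i; now apply Hb. }
  { intros b c (n & N & oN & Ny & Hb) (m & N' & oN' & Ny' & Hc).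
    exists (fun i => n + m <= i /\ N (f i) /\ N' (f i)); split.
    - exists (n + m), (fun z => N z /\ N' z); repeat split; try tauto.
      now apply open_inter.
    - intros i (Hi & HN & HN'); rewrite Hb, Hc; repeat split; auto; lia. }
  exists y, z; intros U V n0 oU oV Uy Vz.
  destruct (Hz V oV Vz (fun n => n0 <= n /\ U (f n))) as (n & [] & ?); [|eauto].
  exists n0, U; tauto.
Qed.

(** * Regularity and entourages in compact Hausdorff spaces *)

(** Points outside [G] are separated from [x] by Hausdorffness, and [G] covers the rest. From a
    finite subcover, [E] intersects the neighbourhoods of [x], and [H] unites the partners disjoint
    from theirs. *)
Lemma compact_regular (Hcomp : compact tX) (Hhaus : hausdorff tX) (x : X) (G : X -> Prop) :
  is_open tX G -> G x ->
  exists E H, is_open tX E /\ is_open tX H /\ E x /\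
    (forall u, E u -> H u -> False) /\ (forall u, G u \/ H u).
Proof.
  intros oG Gx.
  destruct (Hcomp {p : (X -> Prop) * (X -> Prop) |
      is_open tX (fst p) /\ fst p x /\ is_open tX (snd p) /\
      ((forall u, fst p u -> snd p u -> False) \/ forall u, snd p u -> G u)}
    (fun p => snd (proj1_sig p))) as [l Hl].
  - intros [p Hp]; simpl; tauto.
  - intro z. destruct (classic (G z)) as [Gz | nGz].
    + unshelve eexists (exist _ (fun _ => True, G) _); simpl; [|exact Gz].
      split; [apply open_full | tauto].
    + assert (xz : x <> z) by (intros ->; tauto).
      destruct (Hhaus _ _ xz) as (U & V & oU & oV & Ux & Vz & UV).
      unshelve eexists (exist _ (U, V) _); simpl; [|exact Vz]. tauto.
  - exists (fun u => forall p, In p l -> fst (proj1_sig p) u).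
    exists (fun u => exists p,
      (In p l /\ forall v, fst (proj1_sig p) v -> snd (proj1_sig p) v -> False)
      /\ snd (proj1_sig p) u).
    repeat split.
    + apply open_forall_list; intros [p Hp] _; simpl; tauto.
    + apply open_ex; intros [p Hp] _; simpl; tauto.
    + intros [p Hp] _; simpl; tauto.
    + intros u Eu (p & [Hp Hd] & Hu); exact (Hd u (Eu p Hp) Hu).
    + intro u. destruct (Hl u) as (p & Hp & Hu).
      destruct (proj2_sig p) as (_ & _ & _ & [Hd | HG]); [right; exists p; auto | auto].
Qed.

(* Star refinement: [l] indexes finitely many triples (E, G, H) where the E cover X,
   E and H are disjoint, X = G \/ H, and G x G is contained in W. *)
Lemma entourage_half (Hcomp : compact tX) (Hhaus : hausdorff tX) (W : X * X -> Prop) :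
  prod_open tX tX W -> (forall x, W (x, x)) ->
  exists V, prod_open tX tX V /\ (forall x, V (x, x)) /\
    (forall x y, V (x, y) -> V (y, x)) /\
    (forall x y z, V (x, y) -> V (y, z) -> W (x, z)).
Proof.
  intros oW Wrefl.
  destruct (Hcomp {p : (X -> Prop) * (X -> Prop) * (X -> Prop) |
    let '(E, G, H) := p in is_open tX E /\ is_open tX G /\ is_open tX H /\
      (forall u, E u -> H u -> False) /\ (forall u, G u \/ H u) /\
      (forall u v, G u -> G v -> W (u, v))}
    (fun p => fst (fst (proj1_sig p)))) as [l Hl].
  - intros [[[E G] H] Hp]; simpl; tauto.
  - intro x. destruct (oW _ (Wrefl x)) as (U & V & oU & oV & Ux & Vx & UV); simpl in *.
    destruct (compact_regular Hcomp Hhaus x (fun u => U u /\ V u)) as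
      (E & H & oE & oH & Ex & EH & GH); [now apply open_inter | tauto |].
    unshelve eexists (exist _ (E, fun u => U u /\ V u, H) _); simpl; [|exact Ex].
    repeat split; auto; [now apply open_inter | intros u v [] []; auto].
  (* [N x] is a neighbourhood of [x] that, for each triple, lies in [H] if [x] does and in [G]
     otherwise. *)
  - pose (N := fun (x : X) (u : X) => forall p, In p l ->
      let '(E, G, H) := proj1_sig p in (H x -> H u) /\ (~ H x -> G u)).
    assert (oN : forall x, is_open tX (N x)).
    { intro x; apply open_forall_list; intros [[[E G] H] Hp] _; simpl.
      destruct (classic (H x)) as [Hx | nHx].
      - apply open_ext with H; [intro; tauto | tauto].
      - apply open_ext with G; [intro; tauto | tauto]. }
    assert (Nx : forall x, N x x).
    { intros x [[[E G] H] Hp] _; simpl. pose proof Hp as (_ & _ & _ & _ & GH & _).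
      split; [auto | intro; destruct (GH x); tauto]. }
    exists (fun p => exists x, N x (fst p) /\ N x (snd p)); simpl; repeat split.
    + intros [a b] (x & Na & Nb); exists (N x), (N x); simpl in *.
      repeat split; eauto.
    + intro x; exists x; auto.
    + intros x y (z & H1 & H2); exists z; auto.
    + intros x y z (a & Nax & Nay) (b & Nby & Nbz).
      (* In a triple with [y] in [E], [y] is outside [H], hence so are the centres [a] and [b]. This
         puts [x] and [z] in the same [G]. *)
      destruct (Hl y) as (p & Hp & Ey).
      specialize (Nax p Hp); specialize (Nay p Hp); specialize (Nby p Hp);
        specialize (Nbz p Hp).
      destruct p as [[[E G] H] HEGH]; simpl in *.
      pose proof HEGH as (_ & _ & _ & EH & _ & GW).
      assert (nHy : ~ H y) by eauto.
      apply GW; tauto.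
Qed.

Lemma entourage_third (Hcomp : compact tX) (Hhaus : hausdorff tX) (W : X * X -> Prop) :
  prod_open tX tX W -> (forall x, W (x, x)) ->
  exists V, prod_open tX tX V /\ (forall x, V (x, x)) /\
    (forall x y, V (x, y) -> V (y, x)) /\
    (forall x y z w, V (x, y) -> V (y, z) -> V (z, w) -> W (x, w)).
Proof.
  intros oW rW.
  destruct (entourage_half Hcomp Hhaus W oW rW) as (V & oV & rV & sV & VW).
  destruct (entourage_half Hcomp Hhaus V oV rV) as (C & oC & rC & sC & CV).
  exists C; repeat split; auto.
  intros x y z w xy yz zw. apply VW with z; [eauto | apply CV with z; auto].
Qed.

(** * Nets and convergence *)

(** The index set consists of neighbourhoods of [z] paired with a witness, under reverse inclusion
    of the neighbourhoods; carrying the witness in the index avoids choosing one. Two maps are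
    treated at once because proximality requires a common net. *)
Lemma net_exists {A : Type} (f g : A -> X) (Q : A -> Prop) (z : X) :
  (forall U, is_open tX U -> U z -> exists a, Q a /\ U (f a) /\ U (g a)) ->
  exists (D : directed) (t : D -> A), (forall i, Q (t i)) /\
    converges tX (fun i => f (t i)) z /\ converges tX (fun i => g (t i)) z.
Proof.
  intro H.
  pose (T := {p : (X -> Prop) * A | is_open tX (fst p) /\ fst p z /\
               Q (snd p) /\ fst p (f (snd p)) /\ fst p (g (snd p))}).
  assert (mk : forall U, is_open tX U -> U z -> exists i : T, fst (proj1_sig i) = U).
  { intros U oU Uz. destruct (H U oU Uz) as (a & Qa & Ua & Va).
    now unshelve eexists (exist _ (U, a) _). }
  unshelve eexists (@Directed T
    (fun i j => forall x, fst (proj1_sig j) x -> fst (proj1_sig i) x) _ _ _ _).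
  - intros a x; exact (fun h => h).
  - intros a b c ab bc x cx; exact (ab x (bc x cx)).
  - unfold T; intros [[U a] (oU & Uz & HU)] [[V b] (oV & Vz & HV)]; simpl in *.
    destruct (mk (fun x => U x /\ V x)) as [i Hi]; [now apply open_inter | tauto |].
    exists i; rewrite Hi; split; tauto.
  - destruct (mk (fun _ => True)) as [i _]; [apply open_full | exact I | now constructor].
  - exists (fun i => snd (proj1_sig i)). split; [|split].
    + unfold T; intros [p Hp]; simpl; tauto.
    + intros U oU Uz. destruct (mk U oU Uz) as [i <-]. exists i.
      unfold T; simpl; intros [p Hp] Hle; apply Hle; simpl; apply Hp.
    + intros U oU Uz. destruct (mk U oU Uz) as [i <-]. exists i.
      unfold T; simpl; intros [p Hp] Hle; apply Hle; simpl; apply Hp.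
Qed.

(** Turns a neighbourhood of one point into an entourage, so that equicontinuity yields convergence
    to that point. *)
Lemma entourage_at (Hhaus : hausdorff tX) (M : X -> Prop) (a : X) (U : X -> Prop) :
  is_open tX U -> U a -> entourage_of tX M (fun x y => x = a -> U y).
Proof.
  intros oU Ua. exists (fun p => fst p <> a \/ U (snd p)); split; [|split]; simpl.
  - intros [x y] [xa | Uy]; simpl in *.
    + exists (fun z => z <> a), (fun _ => True); simpl.
      repeat split; auto using open_full, open_neq.
    + exists (fun _ => True), U; simpl. repeat split; auto using open_full.
  - intros x _. destruct (classic (x = a)) as [-> | ?]; auto.
  - intros x y _ _ [? | ?]; tauto.
Qed.

Lemma converges_unique (Hhaus : hausdorff tX) (D : directed) (f : D -> X) (x y : X) :
  converges tX f x -> converges tX f y -> x = y.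
Proof.
  intros fx fy. apply NNPP; intro xy.
  destruct (Hhaus _ _ xy) as (U & V & oU & oV & Ux & Vy & UV).
  destruct (fx U oU Ux) as [i Hi], (fy V oV Vy) as [j Hj].
  destruct (dle_dir i j) as (k & ik & jk). eauto.
Qed.

Lemma closed_converges (M : X -> Prop) (D : directed) (f : D -> X) (y : X) :
  is_closed tX M -> (forall i, M (f i)) -> converges tX f y -> M y.
Proof.
  intros cM Mf fy. apply NNPP; intro nMy.
  destruct (fy _ cM nMy) as [i Hi]. exact (Hi i (dle_refl i) (Mf i)).
Qed.

End Topology.

(** * The action and almost automorphy in terms of neighbourhoods *)

Section Flow.

Context {G X : Type} {tG : topology G} {mul : G -> G -> G} {inv : G -> G} {e : G}
  {tX : topology X} {act : G -> X -> X}
  (HG : topological_group tG mul inv e)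
  (Hcomp : compact tX) (Hhaus : hausdorff tX)
  (Hact : continuous_action tG tX mul e act).

Lemma act_inv_l t x : act (inv t) (act t x) = x.
Proof.
  destruct HG as (_ & _ & _ & Vl & _), Hact as (A1 & AM & _).
  now rewrite <- AM, Vl.
Qed.

Lemma act_inv_r t x : act t (act (inv t) x) = x.
Proof.
  destruct HG as (_ & _ & _ & _ & Vr & _), Hact as (A1 & AM & _).
  now rewrite <- AM, Vr.
Qed.

Lemma inv_mul_act s t x : act (inv (mul t s)) x = act (inv s) (act (inv t) x).
Proof.
  rewrite <- (act_inv_l (mul t s) (act (inv s) (act (inv t) x))).
  f_equal. destruct Hact as (_ & AM & _). now rewrite AM, !act_inv_r.
Qed.

Lemma act_continuous t : continuous tX tX (act t).
Proof.
  intros W oW. apply open_local; intros x Wx. destruct Hact as (_ & _ & cA).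
  destruct (cA W oW (t, x) Wx) as (U & V & oU & oV & Ut & Vx & UV); simpl in *.
  exists V; auto.
Qed.

(** If every [V] failed, the failures would form a net with [t x] tending to [y] while [t^-1 y]
    stays outside [U]. *)
Lemma almost_automorphic_nbhd x y (U : X -> Prop) :
  almost_automorphic tX inv act x -> is_open tX U -> U x ->
  exists V, is_open tX V /\ V y /\ forall t, V (act t x) -> U (act (inv t) y).
Proof.
  intros AA oU Ux. apply NNPP; intro H.
  destruct (net_exists tX (fun t => act t x) (fun t => act t x)
              (fun t => ~ U (act (inv t) y)) y) as (D & t & Ht & cv & _).
  - intros V oV Vy. apply NNPP; intro H'. apply H; exists V.
    split; [exact oV | split; [exact Vy|]].
    intros t Vt. apply NNPP; intro nU. apply H'; exists t; auto.
  - destruct (AA D t y cv U oU Ux) as [i Hi]. exact (Ht i (Hi i (dle_refl i))).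
Qed.

(* Almost automorphy is used at y, x0 and x: if t x is near y then t^-1 y is near x,
   so s^-1 t^-1 y is near s^-1 x, which is near x0, and hence t s x0 is near y. *)
Lemma iterated_limit_continuity (AA : forall x, almost_automorphic tX inv act x)
    (x x0 y : X) (W : X -> Prop) :
  is_open tX W -> W y ->
  exists V, is_open tX V /\ V x /\ forall s, V (act s x0) ->
    exists V', is_open tX V' /\ V' y /\ forall t, V' (act t x) -> W (act t (act s x0)).
Proof.
  intros oW Wy.
  destruct (almost_automorphic_nbhd y x0 W (AA y) oW Wy) as (U & oU & Ux0 & HU).
  destruct (almost_automorphic_nbhd x0 x U (AA x0) oU Ux0) as (V & oV & Vx & HV).
  exists V; split; [exact oV | split; [exact Vx|]]. intros s Vs.
  destruct (almost_automorphic_nbhd x y (fun z => U (act (inv s) z)) (AA x))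
    as (V' & oV' & Vy & HV'); [now apply act_continuous | auto |].
  exists V'; split; [exact oV' | split; [exact Vy|]]. intros t Vt.
  specialize (HV' t Vt); simpl in HV'.
  rewrite <- inv_mul_act in HV'. apply HU in HV'.
  assert (E : act (inv (inv (mul t s))) x0 = act (mul t s) x0).
  { rewrite <- (act_inv_l (mul t s) x0) at 1. apply act_inv_l. }
  rewrite E in HV'. destruct Hact as (_ & AM & _). now rewrite AM in HV'.
Qed.

(** * Construction of a uniformly small open set *)

(** Total boundedness of the group elements viewed as maps on a finite set. [P] is arbitrary because
    the induction on [L] splits it according to the ball that contains [act k x]. *)
Lemma finite_net_on_list (C : X * X -> Prop) :
  prod_open tX tX C -> (forall x, C (x, x)) ->
  forall (L : list X) (P : G -> Prop), exists K : list G, forall k, P k ->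
    exists k', In k' K /\ P k' /\ forall x, In x L -> C (act k x, act k' x).
Proof.
  intros oC rC.
  destruct (entourage_half tX Hcomp Hhaus C oC rC) as (D & oD & rD & sD & DC).
  destruct (Hcomp X (fun c z => D (c, z))) as [cs Hcs].
  { intro c; now apply open_slice. }
  { intro x; exists x; apply rD. }
  induction L as [|x L IH]; intro P.
  - destruct (classic (exists k, P k)) as [[k Pk] | nP].
    + exists (k :: nil); intros k' _; exists k; simpl; tauto.
    + exists nil; intros k Pk; exfalso; eauto.
  - assert (Hc : forall cs', exists K : list G, forall k, P k ->
        (exists c, In c cs' /\ D (c, act k x)) ->
        exists k', In k' K /\ P k' /\
          forall z, In z (x :: L) -> C (act k z, act k' z)).
    { induction cs' as [|c cs' [K HK]].
      - exists nil; intros k _ (c & [] & _).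
      - destruct (IH (fun k => P k /\ D (c, act k x))) as [K1 HK1].
        exists (K1 ++ K); intros k Pk (c' & [<- | Hc'] & Dc).
        + destruct (HK1 k (conj Pk Dc)) as (k' & I' & [P' D'] & H'); exists k'.
          rewrite in_app_iff. split; [auto | split; [auto|]].
          intros z [<- | Hz]; eauto.
        + destruct (HK k Pk) as (k' & I' & H'); [eauto|]; exists k'.
          rewrite in_app_iff; auto. }
    destruct (Hc cs) as [K HK]. exists K; intros k Pk; apply HK; auto.
Qed.

Definition uniformly_small (W : X * X -> Prop) (M O : X -> Prop) :=
  forall t y z, M y -> M z -> O y -> O z -> W (act t y, act t z).

Lemma uniformly_small_open_set (AA : forall x, almost_automorphic tX inv act x)
    (M : X -> Prop) (W : X * X -> Prop) :
  minimal_set tX act M -> prod_open tX tX W -> (forall x, W (x, x)) ->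
  exists O, is_open tX O /\ (exists x, M x /\ O x) /\ uniformly_small W M O.
Proof.
  intros (Mne & cM & iM & dM) oW rW. destruct Mne as [x0 Mx0].
  apply NNPP; intro nO.
  (* Each entourage is a third of the previous one: failure of [W] gives failure of [V] at a point,
     then of [B] on an open set, which three [C]-steps finally contradict. *)
  destruct (entourage_third tX Hcomp Hhaus W oW rW) as (V & oV & rV & sV & VW).
  destruct (entourage_third tX Hcomp Hhaus V oV rV) as (B & oB & rB & sB & BV).
  destruct (entourage_third tX Hcomp Hhaus B oB rB) as (C & oC & rC & sC & CB).
  (* A state is the current open set and the list of points produced so far. The conditions on it
     are premises inside the relation, so that choice applies to all states. *)
  assert (step : forall p : (X -> Prop) * list X, exists q : G * G * G * (X -> Prop),
    let '(U, L) := p in let '(k, k', s, U') := q in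
    is_open tX U -> (exists x, M x /\ U x) ->
    is_open tX U' /\ (forall u, U' u -> U u) /\ U' (act s x0) /\
    (forall x, In x L -> C (act k x, act k' x)) /\
    (forall u, U' u -> ~ B (act k u, act k' u))).
  { intros [U L].
    destruct (classic (is_open tX U /\ exists x, M x /\ U x)) as [[oU [u [Mu Uu]]] | nU].
    2: { destruct (dM x0 x0 Mx0 Mx0 _ (open_full tX) I) as [t _].
         (* An arbitrary default, since the premises fail for this state. *)
         exists (t, t, t, U); tauto. }
    destruct (finite_net_on_list C oC rC L (fun _ => True)) as [K HK].
    destruct (entourage_half tX Hcomp Hhaus V oV rV) as (D & oD & rD & sD & DV).
    (* Every element of the finite net [K] is [V]-small on [U1], whereas some [k] is not [W]-small
       there. Hence [k] and its approximant [k'] are [V]-far at one of the two points witnessing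
       this. *)
    pose (U1 := fun z => U z /\ forall k, In k K -> D (act k u, act k z)).
    assert (oU1 : is_open tX U1).
    { apply open_inter; [exact oU|]. apply open_forall_list; intros k _.
      apply (act_continuous k (fun z => D (act k u, z))). now apply open_slice. }
    assert (Hk : exists k y z, M y /\ M z /\ U1 y /\ U1 z /\ ~ W (act k y, act k z)).
    { apply NNPP; intro H. apply nO; exists U1; split; [exact oU1 | split].
      - exists u; split; [exact Mu | split; [exact Uu | intros; apply rD]].
      - intros k y z My Mz Uy Uz. apply NNPP; intro HW. apply H.
        exists k, y, z; auto. }
    destruct Hk as (k & y & z & My & Mz & [Uy Dy] & [Uz Dz] & nW).
    destruct (HK k I) as (k' & Kk' & _ & HC).
    assert (Hw : exists w, M w /\ U w /\ ~ V (act k w, act k' w)).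
    { apply NNPP; intro H. apply nW, VW with (act k' y) (act k' z).
      - apply NNPP; intro; apply H; exists y; auto.
      - apply DV with (act k' u); auto.
      - apply sV, NNPP; intro; apply H; exists z; auto. }
    destruct Hw as (w & Mw & Uw & nV).
    (* On [U'] both [k] and [k'] move points [C]-close to their images of [w], so [V]-farness at [w]
       leaves them [B]-far throughout. *)
    pose (U' := fun v => (U v /\ C (act k w, act k v)) /\ C (act k' w, act k' v)).
    assert (oU' : is_open tX U').
    { apply open_inter; [apply open_inter; [exact oU|]|].
      - apply (act_continuous k (fun v => C (act k w, v))); now apply open_slice.
      - apply (act_continuous k' (fun v => C (act k' w, v))); now apply open_slice. }
    destruct (dM x0 w Mx0 Mw U' oU') as [s Hs]; [unfold U'; auto|].
    exists (k, k', s, U'); intros _ _.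
    split; [exact oU' | split; [|split; [exact Hs | split; [exact HC|]]]].
    - intros v [[Uv _] _]; exact Uv.
    - intros v [[_ Cv] Cv'] Bv. apply nV.
      apply BV with (act k v) (act k' v); [|exact Bv|].
      + apply CB with (act k v) (act k v); auto.
      + apply sB, CB with (act k' v) (act k' v); auto. }
  apply functional_choice in step; destruct step as [F HF].
  pose (next := fun p : (X -> Prop) * list X =>
    let '(_, _, s, U') := F p in (U', act s x0 :: snd p)).
  (* The list at stage [n] holds [pt m] for [m < n], so [k n] and [k' n] are close on those points
     only; [pt n] itself lies in the open set of stage [S n], where they are far apart. *)
  pose (st := fun n => Nat.iter n next (fun _ => True, nil)).
  pose (k := fun n => fst (fst (fst (F (st n))))).
  pose (k' := fun n => snd (fst (fst (F (st n))))).
  pose (pt := fun n => act (snd (fst (F (st n)))) x0).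
  assert (stS : forall n, st (S n) = (snd (F (st n)), pt n :: snd (st n))).
  { intro n. unfold st at 1; simpl. fold (st n). unfold next, pt.
    now destruct (F (st n)) as [[[a b] c] d]. }
  assert (inv_st : forall n, is_open tX (fst (st n)) /\ exists x, M x /\ fst (st n) x).
  { induction n as [|n [oU mU]].
    - split; [apply open_full | exists x0; simpl; auto].
    - rewrite stS; simpl. specialize (HF (st n)). unfold pt in *.
      destruct (st n) as [U L], (F (U, L)) as [[[a b] s] U']; simpl in *.
      destruct (HF oU mU) as (oU' & _ & Us & _). eauto. }
  assert (Hst : forall n, let U := fst (st n) in let U' := fst (st (S n)) in
    (forall u, U' u -> U u) /\ U' (pt n) /\
    (forall x, In x (snd (st n)) -> C (act (k n) x, act (k' n) x)) /\
    (forall u, U' u -> ~ B (act (k n) u, act (k' n) u))).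
  { intro n; rewrite stS. destruct (inv_st n) as [oU mU].
    specialize (HF (st n)). unfold pt, k, k' in *.
    destruct (st n) as [U L], (F (U, L)) as [[[a b] s] U']; simpl in *. tauto. }
  assert (mono : forall m n u, m <= n -> fst (st n) u -> fst (st m) u).
  { intros m n u mn. induction mn as [|n mn IH]; [auto|].
    intro Hu; apply IH, Hst, Hu. }
  assert (memL : forall m n, m < n -> In (pt m) (snd (st n))).
  { intros m n mn. induction mn as [|n mn IH]; rewrite stS; simpl; auto. }
  destruct (sequence_cluster_point tX Hcomp pt) as [x Hx].
  (* [B]-closeness at [x] is an open condition, so it would pass to some [pt i] with [i >= n]; but
     that point lies in the open set of stage [S n]. *)
  assert (far : forall n, ~ B (act (k n) x, act (k' n) x)).
  { intros n HB.
    destruct (Hx (fun u => B (act (k n) u, act (k' n) u))) with (n0 := n) as (i & ni & Bi).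
    - apply open_comp_pair; auto using act_continuous.
    - exact HB.
    - apply (proj2 (proj2 (proj2 (Hst n))) (pt i)); [|exact Bi].
      apply mono with (S i); [lia | apply Hst]. }
  destruct (pair_sequence_cluster_point tX Hcomp (fun n => act (k n) x)
              (fun n => act (k' n) x)) as (y & y' & joint).
  assert (nB : ~ B (y, y')).
  { intro HB. destruct (oB _ HB) as (N & N' & oN & oN' & Ny & Ny' & NN); simpl in *.
    destruct (joint N N' 0 oN oN' Ny Ny') as (n & _ & Hn & Hn').
    exact (far n (NN _ _ Hn Hn')). }
  destruct (iterated_limit_continuity AA x x0 y (fun z => C (y, z)))
    as (V1 & oV1 & V1x & H1); [now apply open_slice | auto |].
  destruct (iterated_limit_continuity AA x x0 y' (fun z => C (y', z)))
    as (V2 & oV2 & V2x & H2); [now apply open_slice | auto |].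
  (* The order matters: [j] is fixed first, [N] and [N'] depend on it, and only then is [m > j]
     taken, so that [pt j] is in the list of stage [m]. *)
  destruct (Hx (fun z => V1 z /\ V2 z)) with (n0 := 0)
    as (j & _ & Vj1 & Vj2); [now apply open_inter | auto |].
  destruct (H1 _ Vj1) as (N & oN & Ny & HN), (H2 _ Vj2) as (N' & oN' & Ny' & HN').
  destruct (joint N N' (S j) oN oN' Ny Ny') as (m & jm & Nm & Nm').
  apply nB, CB with (act (k m) (pt j)) (act (k' m) (pt j)).
  - apply HN, Nm.
  - apply Hst, memL, jm.
  - apply sC, HN', Nm'.
Qed.

(** * Distality and equicontinuity from almost automorphy *)

Lemma almost_automorphic_distal :
  (forall x, almost_automorphic tX inv act x) -> distal tX act.
Proof.
  intros AA x y xy (D & t & z & tx & ty). apply xy.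
  apply (converges_unique tX Hhaus D (fun i => act (inv (t i)) z)).
  - exact (AA x D t z tx).
  - exact (AA y D t z ty).
Qed.

Lemma almost_automorphic_equicontinuous (M : X -> Prop) :
  (forall x, almost_automorphic tX inv act x) ->
  minimal_set tX act M -> equicontinuous_on tX act M.
Proof.
  intros AA mM alpha (W0 & oW0 & rW0 & W0alpha).
  pose proof mM as (_ & cM & iM & dM).
  (* All pairs outside [M] x [M] are added to [W0], making it reflexive on the whole of [X]; it
     stays open because [M] is closed. *)
  pose (W := fun p : X * X => M (fst p) -> M (snd p) -> W0 p).
  assert (oW : prod_open tX tX W).
  { intros [a b] Hab; unfold W in *; simpl in *.
    destruct (classic (M a)) as [Ma | nMa].
    - destruct (classic (M b)) as [Mb | nMb].
      + destruct (oW0 _ (Hab Ma Mb)) as (U & V & oU & oV & Ua & Vb & UV).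
        exists U, V; simpl in *; repeat split; auto.
      + exists (fun _ => True), (fun z => ~ M z); simpl.
        repeat split; auto using open_full; tauto.
    - exists (fun z => ~ M z), (fun _ => True); simpl.
      repeat split; auto using open_full; tauto. }
  destruct (uniformly_small_open_set AA M W mM oW) as (O & oO & (u & Mu & Ou) & HO).
  { intro x; unfold W; simpl; auto. }
  pose (W1 := fun p : X * X => exists N, is_open tX N /\ uniformly_small W M N /\
                N (fst p) /\ N (snd p)).
  exists (fun a b => W1 (a, b)); split.
  - exists W1; split; [|split; [|auto]].
    + intros [a b] (N & oN & sN & Na & Nb); exists N, N; simpl in *.
      repeat split; auto. intros c d Nc Nd; exists N; auto.
    + intros x Mx. destruct (dM x u Mx Mu O oO Ou) as [s Os].
      (* The pullback of [O] by [s] is again uniformly small, since [t] acts as [t s^-1] after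
         [s]. *)
      exists (fun z => O (act s z)); simpl; repeat split; auto.
      * now apply act_continuous.
      * intros t y z My Mz Oy Oz.
        rewrite <- (act_inv_l s y), <- (act_inv_l s z).
        destruct Hact as (_ & AM & _). rewrite <- !(AM t (inv s)). apply HO; auto.
  - intros x y Mx My (N & oN & sN & Nx & Ny) t.
    apply W0alpha; auto. apply (sN t x y Mx My Nx Ny); simpl; auto.
Qed.

(** * Orbit closures, minimal subsets and the converse *)

Definition orbit_closure (x y : X) : Prop :=
  forall U, is_open tX U -> U y -> exists t, U (act t x).

Lemma orbit_closure_closed x : is_closed tX (orbit_closure x).
Proof.
  apply open_local; intros y Hy.
  apply NNPP; intro H; apply Hy; intros U oU Uy.
  apply NNPP; intro nt; apply H; exists U; split; [exact oU | split; [exact Uy|]].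
  intros z Uz Hz; exact (nt (Hz U oU Uz)).
Qed.

Lemma orbit_closure_invariant x t y : orbit_closure x y -> orbit_closure x (act t y).
Proof.
  intros Hy U oU Uy.
  destruct (Hy (fun z => U (act t z))) as [s Hs]; [now apply act_continuous | exact Uy |].
  exists (mul t s). destruct Hact as (_ & AM & _). now rewrite AM.
Qed.

(* Zorn's lemma is applied to the open invariant sets not covering [A]:
   the complement in [A] of a maximal one is minimal. *)
Lemma minimal_subset_exists (A : X -> Prop) :
  (exists x, A x) -> is_closed tX A -> (forall t x, A x -> A (act t x)) ->
  exists M, minimal_set tX act M /\ forall x, M x -> A x.
Proof.
  intros [a Aa] cA iA.
  destruct (@classical_sets.Zorn_bigcup X (fun B => is_open tX B /\
    (forall t x, B (act t x) -> B x) /\ exists x, A x /\ ~ B x))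
    as (B & (oB & iB & (x & Ax & nBx)) & maxB).
  - intros F HF Ftot. split; [|split].
    + apply open_ext with (fun x => exists B, F B /\ B x).
      * intro x; split; [intros (B & FB & Bx); now exists B |
          intros [B FB Bx]; now exists B].
      * apply open_ex; intros B FB; exact (proj1 (HF B FB)).
    + intros t x [B FB Bx]; exists B; [exact FB|]. exact (proj1 (proj2 (HF B FB)) t x Bx).
    + apply NNPP; intro H.
      (* If the union of the chain covered [A], its members and the complement of [A] would cover
         [X]. The largest chain member in a finite subcover would then contain [A]; if there is
         none, [a] is left uncovered. *)
      destruct (Hcomp {B | is_open tX B /\ (F B \/ forall x, B x -> ~ A x)}
        (fun B => proj1_sig B)) as [l Hl].
      * intros [B [oB ?]]; exact oB.
      * intro x. destruct (classic (A x)) as [Ax | nAx].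
        -- apply NNPP; intro H'. apply H; exists x; split; [exact Ax|].
           intros [B FB Bx]. apply H'.
           unshelve eexists (exist _ B _); [|exact Bx].
           split; [exact (proj1 (HF B FB)) | auto].
        -- unshelve eexists (exist _ (fun z => ~ A z) _); [|exact nAx].
           split; [exact cA | auto].
      * assert (Hb : (forall B, In B l -> ~ F (proj1_sig B)) \/ exists B, F B /\
          forall B', In B' l -> F (proj1_sig B') -> forall x, proj1_sig B' x -> B x).
        { clear Hl; induction l as [|[B HB] l IH]; [left; simpl; auto|].
          destruct (classic (F B)) as [FB | nFB].
          - right. destruct IH as [IH | (B' & FB' & IH)].
            + exists B; split; [exact FB|]. intros B' [<- | HB']; [simpl; auto|].
              intro FB'; exfalso; exact (IH B' HB' FB').
            + destruct (Ftot B B' FB FB') as [BB' | B'B].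
              * exists B'; split; [exact FB'|]. intros B'' [<- | HB'']; [simpl; auto|].
                intro; now apply IH.
              * exists B; split; [exact FB|]. intros B'' [<- | HB'']; [simpl; auto|].
                intros FB'' z Bz; exact (B'B z (IH B'' HB'' FB'' z Bz)).
          - destruct IH as [IH | (B' & FB' & IH)]; [left | right].
            + intros B' [<- | HB']; [exact nFB | auto].
            + exists B'; split; [exact FB'|].
              intros B'' [<- | HB'']; [simpl; tauto | exact (IH B'' HB'')]. }
        destruct Hb as [Hb | (B & FB & Hb)].
        -- destruct (Hl a) as ([B [oB [FB | nA]]] & Bl & Ba);
             [exact (Hb _ Bl FB) | exact (nA a Ba Aa)].
        -- destruct (HF B FB) as (_ & _ & x & Ax & nBx). apply nBx.
           destruct (Hl x) as ([B' [oB' [FB' | nA]]] & Bl & Bx);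
             [exact (Hb _ Bl FB' x Bx) | destruct (nA x Bx Ax)].
  - exists (fun x => A x /\ ~ B x); split; [|tauto]. split; [|split; [|split]].
    + eauto.
    + apply open_ext with (fun x => ~ A x \/ B x); [intro; tauto | now apply open_or].
    + intros t z [Az nBz]; split; [auto | intro; apply nBz, (iB t); auto].
    + clear x Ax nBx. intros x y [Ax nBx] [Ay nBy] U oU Uy.
      apply NNPP; intro nt.
      (* [B] is enlarged by the points whose orbit meets [U]: this adds [y], through the identity,
         but not [x], contradicting maximality. *)
      apply (maxB (fun z => B z \/ exists t, True /\ U (act t z))).
      * split; [intros z Bz; now left|]. intro H. apply nBy, (H y).
        right. exists e. destruct Hact as (A1 & _). now rewrite A1.
      * split; [|split].
        -- apply open_or; [exact oB|]. apply open_ex.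
           intros t _; now apply act_continuous.
        -- intros t z [Bz | (s & _ & Us)]; [left; now apply (iB t)|].
           right; exists (mul s t). destruct Hact as (_ & AM & _). now rewrite AM.
        -- exists x; split; [exact Ax|]. intros [Bx | (t & _ & Ut)]; eauto.
Qed.

(* With m0 in M a limit of t x and m1 a cluster point of t^-1 m0, equicontinuity on M
   makes t m1 close to t (t^-1 m0) = m0: x and m1 are proximal, hence equal. *)
Lemma distal_in_minimal_set (x : X) (M : X -> Prop) :
  distal tX act -> minimal_set tX act M -> equicontinuous_on tX act M ->
  (forall y, M y -> orbit_closure x y) -> M x.
Proof.
  intros dist ([m0 Mm0] & cM & iM & _) eqM Mx.
  (* The filter base consists of the sets of [t] bringing [x] near [m0], so that a single [t] serves
     both limits. *)
  destruct (cluster_point tX Hcomp (fun b => exists U, is_open tX U /\ U m0 /\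
      forall t, b t <-> U (act t x)) (fun t => act (inv t) m0)) as [m1 Hm1].
  { exists (fun t => True), (fun _ => True). repeat split; auto using open_full. }
  { intros b (U & oU & Um & Hb). destruct (Mx m0 Mm0 U oU Um) as [t Ut].
    exists t; now apply Hb. }
  { intros b c (U & oU & Um & Hb) (V & oV & Vm & Hc).
    exists (fun t => U (act t x) /\ V (act t x)); split.
    - exists (fun z => U z /\ V z); repeat split; try tauto. now apply open_inter.
    - intros t []; rewrite Hb, Hc; auto. }
  assert (Mm1 : M m1).
  { apply NNPP; intro nM.
    destruct (Hm1 _ cM nM (fun t => True)) as (t & _ & Ht).
    - exists (fun _ => True); repeat split; auto using open_full.
    - apply Ht; auto. }
  destruct (classic (x = m1)) as [-> | xm]; [exact Mm1|].
  exfalso; apply (dist x m1 xm).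
  destruct (net_exists tX (fun t => act t x) (fun t => act t m1) (fun _ => True) m0)
    as (D & t & _ & Hx & Hm); [|now exists D, t, m0].
  intros U oU Um.
  destruct (eqM (fun a b => a = m0 -> U b)) as (beta & (W & oW & rW & Wbeta) & Hbeta).
  { now apply entourage_at. }
  destruct (oW _ (rW m1 Mm1)) as (N & N' & oN & oN' & Nm & Nm' & NN); simpl in *.
  destruct (Hm1 N oN Nm (fun t => U (act t x))) as (t & Ut & Nt).
  { exists U; repeat split; auto. }
  exists t; split; [exact I | split; [exact Ut|]].
  apply (Hbeta (act (inv t) m0) m1); auto using act_inv_r.
Qed.

(** Equicontinuity is uniform over the group, hence covers inverses: once [t_i x] is close to [y],
    applying [t_i^-1] keeps [x] close to [t_i^-1 y]. *)
Lemma equicontinuous_almost_automorphic (M : X -> Prop) (x : X) :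
  is_closed tX M -> (forall t z, M z -> M (act t z)) -> equicontinuous_on tX act M ->
  M x -> almost_automorphic tX inv act x.
Proof.
  intros cM iM eqM Mx D t y ty U oU Ux.
  assert (My : M y).
  { apply (closed_converges tX M D (fun i => act (t i) x)); auto. }
  destruct (eqM (fun a b => a = x -> U b)) as (beta & (W & oW & rW & Wbeta) & Hbeta).
  { now apply entourage_at. }
  destruct (oW _ (rW y My)) as (N & N' & oN & oN' & Ny & Ny' & NN); simpl in *.
  destruct (ty N oN Ny) as [i0 Hi0]. exists i0; intros i Hi.
  apply (Hbeta (act (t i) x) y); auto using act_inv_l.
Qed.

End Flow.

Theorem mainTheorem5
  (G : Type) (tG : topology G) (mul : G -> G -> G) (inv : G -> G) (e : G)
  (X : Type) (tX : topology X) (act : G -> X -> X)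
  (HG : topological_group tG mul inv e)
  (Hcomp : compact tX) (Hhaus : hausdorff tX)
  (Hact : continuous_action tG tX mul e act) :
  (forall x : X, almost_automorphic tX inv act x) <->
  (distal tX act /\
   forall M : X -> Prop, minimal_set tX act M -> equicontinuous_on tX act M).
Proof.
  split.
  - intro AA; split.
    + exact (almost_automorphic_distal (inv := inv) Hhaus AA).
    + intros M mM; now apply (almost_automorphic_equicontinuous HG Hcomp Hhaus Hact).
  - intros [dist eqc] x.
    destruct (minimal_subset_exists Hcomp Hact (orbit_closure (tX := tX) (act := act) x))
      as (M & mM & Mx).
    + exists x. intros U oU Ux. exists e. destruct Hact as (A1 & _). now rewrite A1.
    + apply orbit_closure_closed.
    + intros t y. apply (orbit_closure_invariant Hact).
    + assert (Hx := distal_in_minimal_set HG Hcomp Hhaus Hact x M dist mM (eqc M mM) Mx).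
      pose proof mM as (_ & cM & iM & _).
      exact (equicontinuous_almost_automorphic HG Hhaus Hact M x cM iM (eqc M mM) Hx).
Qed.
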